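(* Let $\{G_i=(V_i,E_i)\}_{i=1}^N$ be a family of regular graphs, where $G_i$ has valency $D_i$ and diameter $L_i$ for each $i$. Let $G=G_1\times\cdots\times G_N$. The following are equivalent: (i) $G$ is Bonnet-Myers sharp. (ii) Each $G_i$ is Bonnet-Myers sharp and $\frac{D_1}{L_1}=\cdots=\frac{D_N}{L_N}$.
   Context: All graphs are finite, simple, undirected, unweighted, connected, and have at least one edge. $d$ denotes the combinatorial distance and $\mathrm{diam}(G)=\max_{x,y}d(x,y)$; $x\sim y$ means that $x,y$ are adjacent. The Cartesian product $G_1\times\cdots\times G_N$ has vertex set $V_1\times\cdots\times V_N$, two vertices being adjacent iff they differ in exactly one coordinate and their entries in that coordinate are adjacent. For a $D$-regular graph $G=(V,E)$ and $x\in V$, let $\mu_x$ be the probability measure on $V$ giving mass $\frac1{D+1}$ to $x$ and to each of its $D$ neighbours. The Wasserstein distance of probability measures $\mu,\nu$ on $V$ is $W_1(\mu,\nu)=\inf_\pi\sum_{u,v\in V}d(u,v)\pi(u,v)$, where $\pi:V\times V\to[0,1]$ runs over all couplings with marginals $\mu$ and $\nu$. The (modified) Ollivier Ricci curvature of two different vertices $x,y$ is $$\kappa(x,y)=\frac{D+1}{D}\left(1-\frac{W_1(\mu_x,\mu_y)}{d(x,y)}\right).$$ A $D$-regular graph $G$ of diameter $L$ is called Bonnet-Myers sharp if $\inf_{x\sim y}\kappa(x,y)=\frac2L$. *)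

(* Defs.v *)
From HB Require Import structures.
From mathcomp Require Import all_boot all_order all_algebra.
From mathcomp Require Import boolp classical_sets reals.
Set Implicit Arguments.
Unset Strict Implicit.
Unset Printing Implicit Defensive.

Import Order.TTheory GRing.Theory Num.Theory.
Local Open Scope classical_set_scope.
Local Open Scope ring_scope.

Definition is_graph (T : finType) (e : rel T) : Prop :=
  [/\ symmetric e, irreflexive e, (forall x y, connect e x y)
    & exists x y, e x y].

Definition regular (T : finType) (e : rel T) (D : nat) : Prop :=
  forall x, #|[set y | e x y]%SET| = D.

(* [find] returns the least length k < #|T| of a walk from x to y; in a
   connected graph shortest walks are that short, so the fallback value #|T|
   of [find] is never taken. *)
Definition dist (T : finType) (e : rel T) (x y : T) : nat :=
  find (fun k => [exists p : k.-tuple T, path e x p && (last x p == y)])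
       (iota 0 #|T|).

Definition diam (T : finType) (e : rel T) : nat :=
  (\max_(x : T) \max_(y : T) dist e x y)%N.

Definition cart_prod (N : nat) (V : 'I_N -> finType)
    (E : forall i, rel (V i)) : rel {dffun forall i : 'I_N, V i} :=
  fun x y => [exists i, [forall j, (x j != y j) == (j == i)]
                        && E i (x i) (y i)].

Section Curvature.
Variables (R : realType) (T : finType) (e : rel T).

Definition mu (D : nat) (x : T) : T -> R :=
  fun y => if (y == x) || e x y then (D.+1)%:R^-1 else 0.

Definition coupling (m n : T -> R) (p : T -> T -> R) : Prop :=
  [/\ forall u v, 0 <= p u v <= 1,
      forall u, \sum_v p u v = m u
    & forall v, \sum_u p u v = n v].

Definition W1 (m n : T -> R) : R :=
  inf [set \sum_u \sum_v (dist e u v)%:R * p u v | p in coupling m n].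

Definition kappa (D : nat) (x y : T) : R :=
  (D.+1)%:R / D%:R * (1 - W1 (mu D x) (mu D y) / (dist e x y)%:R).

Definition bonnet_myers_sharp : Prop :=
  exists2 D : nat, regular e D &
    inf [set kappa D q.1 q.2 | q in [set q : T * T | e q.1 q.2]]
      = 2 / (diam e)%:R.

End Curvature.

(* Main.v *)
Require Import Defs.
From mathcomp Require Import all_boot all_order all_algebra.
From mathcomp Require Import ring lra.
From mathcomp Require Import boolp classical_sets reals.
Set Implicit Arguments.
Unset Strict Implicit.
Unset Printing Implicit Defensive.

Import Order.TTheory GRing.Theory Num.Theory.
Local Open Scope ring_scope.

(** Everything is expressed through transports of the unnormalised ball
    measures, that is, the indicator of the closed unit ball around a vertex.
    In a [D]-regular graph, the curvature of an edge [x ~ y] is at least [t]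
    iff the ball around [x] can be carried onto the ball around [y] at a cost
    arbitrarily close to [D + 1 - t D] ([kappa_ge]).

    Consider now an edge of the product, in direction [i], and let [k] be the
    sum of the [D j] for [j != i].  The two balls consist of the balls of
    [E i] in the line through the edge, and of [k] further pairs of neighbours
    that face each other at distance 1.  So a transport of cost [c] in [E i]
    gives one of cost [c + k] in the product.  Conversely, projecting to
    coordinate [i] turns the [k] further vertices into an extra mass [k] at the
    two endpoints.  A transport from [ball x + k delta_x] to
    [ball y + k delta_y] can be modified, without raising its cost, so that
    exactly the mass [k] goes from [x] to [y] along the edge; the rest is a
    transport of balls ([lazy_ball_transport]).  Hence the curvature of the
    edge in the product is [D i / D] times its curvature in [E i]
    ([cart_prod_kappa]), where [D] is the sum of the valencies.

    Two facts then give the theorem.  The diameter [L] of the product is the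
    sum of the diameters [L i] ([cart_prod_diam]).  By the discrete
    Bonnet-Myers inequality ([bonnet_myers]) the least curvature of an edge is
    at most [2 / diameter], so that being sharp means that every edge has
    curvature at least [2 / diameter] ([sharpP]).  If the product is sharp,
    every edge of [E i] has curvature at least [2 D / (L D i)], whence
    [L i * D <= L * D i] by Bonnet-Myers; both sides have the same sum over
    [i], so equality holds for every [i], which is the equality of the ratios
    and the sharpness of the factors.  The converse is the same computation
    read backwards. *)

(** * Transport plans on a finite space *)

Section Transport.
Variables (R : realFieldType).

Definition dirac_mass (T : finType) (x : T) : T -> R := fun y => (y == x)%:R.

Definition pushforward (T T' : finType) (f : T -> T') (m : T -> R) : T' -> R :=
  fun b => \sum_(a | f a == b) m a.

Definition is_plan (T : finType) (m n : T -> R) (p : T -> T -> R) : Prop :=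
  [/\ forall u v, 0 <= p u v, forall u, \sum_v p u v = m u
    & forall v, \sum_u p u v = n v].

Definition plan_cost (T : finType) (d p : T -> T -> R) : R :=
  \sum_u \sum_v d u v * p u v.

(** A bound on the cost of some plan: this avoids the question whether the
    infimum defining the Wasserstein distance is attained.  The total masses
    are arbitrary, so such bounds can be added, scaled and pushed forward. *)
Definition transportable (T : finType) (d : T -> T -> R) (m n : T -> R) (c : R) :=
  exists2 p, is_plan m n p & plan_cost d p <= c.

Lemma sum_dirac (T : finType) (x : T) (F : T -> R) :
  \sum_y (y == x)%:R * F y = F x.
Proof.
rewrite (bigD1 x) //= eqxx mul1r big1 ?addr0 // => y /negPf ->.
by rewrite mul0r.
Qed.

Section OneSpace.
Variables (T : finType) (d : T -> T -> R).

Lemma plan_cost0 : plan_cost d (fun _ _ => 0) = 0.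
Proof. by apply: big1 => u _; apply: big1 => v _; rewrite mulr0. Qed.

Lemma plan_costD p q :
  plan_cost d (fun u v => p u v + q u v) = plan_cost d p + plan_cost d q.
Proof.
rewrite /plan_cost -big_split; apply: eq_bigr => u _.
by rewrite -big_split; apply: eq_bigr => v _; rewrite mulrDr.
Qed.

Lemma plan_costZ a p : plan_cost d (fun u v => a * p u v) = a * plan_cost d p.
Proof.
rewrite /plan_cost mulr_sumr; apply: eq_bigr => u _.
by rewrite mulr_sumr; apply: eq_bigr => v _; rewrite mulrCA.
Qed.

Lemma plan_costN p : plan_cost d (fun u v => - p u v) = - plan_cost d p.
Proof.
rewrite -mulN1r -plan_costZ; apply: eq_bigr => u _; apply: eq_bigr => v _.
by rewrite mulN1r.
Qed.

Lemma plan_cost_row x (q : T -> R) :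
  plan_cost d (fun u v => (u == x)%:R * q v) = \sum_v d x v * q v.
Proof.
rewrite -(sum_dirac x (fun u => \sum_v d u v * q v)).
apply: eq_bigr => u _; rewrite mulr_sumr; apply: eq_bigr => v _.
by rewrite mulrCA.
Qed.

Lemma plan_cost_col y (q : T -> R) :
  plan_cost d (fun u v => (v == y)%:R * q u) = \sum_u d u y * q u.
Proof.
apply: eq_bigr => u _; rewrite -(sum_dirac y (fun v => d u v * q u)).
by apply: eq_bigr => v _; rewrite mulrCA.
Qed.

Lemma transportable_eq m n m' n' c : m =1 m' -> n =1 n' ->
  transportable d m n c -> transportable d m' n' c.
Proof. by move=> /funext -> /funext ->. Qed.

Lemma transportable0 : transportable d (fun=> 0) (fun=> 0) 0.
Proof.
exists (fun _ _ => 0); last by rewrite plan_cost0.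
by split=> // [u|v]; rewrite big1.
Qed.

Lemma transportableD m n c m' n' c' :
  transportable d m n c -> transportable d m' n' c' ->
  transportable d (fun x => m x + m' x) (fun x => n x + n' x) (c + c').
Proof.
move=> [p [p0 pm pn] pc] [q [q0 qm qn] qc].
exists (fun u v => p u v + q u v); last by rewrite plan_costD lerD.
split=> [u v|u|v]; first by rewrite addr_ge0.
  by rewrite big_split /= pm qm.
by rewrite big_split /= pn qn.
Qed.

Lemma transportable_sum (I : finType) (P : pred I) (m n : I -> T -> R) c :
  (forall i, P i -> transportable d (m i) (n i) (c i)) ->
  transportable d (fun x => \sum_(i | P i) m i x) (fun x => \sum_(i | P i) n i x)
    (\sum_(i | P i) c i).
Proof.
move=> H.
suff: forall s : seq I, transportable d (fun x => \sum_(i <- s | P i) m i x)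
   (fun x => \sum_(i <- s | P i) n i x) (\sum_(i <- s | P i) c i) by exact.
elim=> [|i s IH].
  rewrite big_nil; apply: transportable_eq transportable0 => x;
  by rewrite big_nil.
rewrite big_cons; case: ifP => Pi.
  by apply: transportable_eq (transportableD (H _ Pi) IH) => x;
  rewrite big_cons Pi.
by apply: transportable_eq IH => x; rewrite big_cons Pi.
Qed.

Lemma transportableZ a m n c : 0 <= a -> transportable d m n c ->
  transportable d (fun x => a * m x) (fun x => a * n x) (a * c).
Proof.
move=> a0 [p [p0 pm pn] pc].
exists (fun u v => a * p u v); last by rewrite plan_costZ ler_wpM2l.
split=> [u v|u|v]; first by rewrite mulr_ge0.
  by rewrite -mulr_sumr pm.
by rewrite -mulr_sumr pn.
Qed.

Lemma transportable_dirac x y :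
  transportable d (dirac_mass x) (dirac_mass y) (d x y).
Proof.
exists (fun u v => (u == x)%:R * (v == y)%:R).
  split=> [u v|u|v]; first by rewrite mulr_ge0 ?ler0n.
    rewrite -mulr_sumr (eq_bigr (fun v => (v == y)%:R * 1)) ?sum_dirac ?mulr1 //.
    by move=> v _; rewrite mulr1.
  by rewrite (sum_dirac x (fun=> _)).
rewrite plan_cost_row -(sum_dirac y (d x)) le_eqVlt; apply/orP; left.
by apply/eqP; apply: eq_bigr => v _; rewrite mulrC.
Qed.

Lemma transportable_refl m : (forall x, 0 <= m x) -> (forall x, d x x = 0) ->
  transportable d m m 0.
Proof.
move=> m0 d0.
have := @transportable_sum T predT (fun i u => m i * dirac_mass i u)
  (fun i u => m i * dirac_mass i u) (fun i => m i * 0).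
rewrite big1; last by move=> i _; rewrite mulr0.
have E x : \sum_i m i * dirac_mass i x = m x.
  by rewrite -[RHS](sum_dirac x m); apply: eq_bigr => i _;
     rewrite mulrC /dirac_mass eq_sym.
move=> H; apply: transportable_eq (H _) => // i _.
by apply: transportableZ => //; have := transportable_dirac i i; rewrite d0.
Qed.

(** Weak Kantorovich duality: a 1-Lipschitz function is a test function whose
    integral cannot grow by more than the price of the transport. *)
Lemma transportable_lipschitz m n c (f : T -> R) :
  (forall u v, f v - f u <= d u v) -> transportable d m n c ->
  \sum_v n v * f v - \sum_u m u * f u <= c.
Proof.
move=> fL [p [p0 pm pn] pc]; apply: le_trans pc.
have -> : \sum_v n v * f v = \sum_u \sum_v p u v * f v.
  rewrite exchange_big; apply: eq_bigr => v _.
  by rewrite -mulr_suml pn.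
have -> : \sum_u m u * f u = \sum_u \sum_v p u v * f u.
  by apply: eq_bigr => u _; rewrite -mulr_suml pm.
rewrite -sumrB; apply: ler_sum => u _; rewrite -sumrB; apply: ler_sum => v _.
by rewrite -mulrBr mulrC ler_wpM2r.
Qed.

Lemma plan_pos_row (m n : T -> R) p u v : is_plan m n p -> 0 < p u v -> 0 < m u.
Proof.
move=> [p0 pm _] puv; rewrite -pm (bigD1 v) //=.
by apply: ltr_wpDr => //; apply: sumr_ge0 => *.
Qed.

Lemma plan_pos_col (m n : T -> R) p u v : is_plan m n p -> 0 < p u v -> 0 < n v.
Proof.
move=> [p0 _ pn] puv; rewrite -pn (bigD1 u) //=.
by apply: ltr_wpDr => //; apply: sumr_ge0 => *.
Qed.

Lemma plan_remove_direct (m n : T -> R) p x y a : is_plan m n p -> 0 <= a <= p x y ->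
  is_plan (fun u => m u - a * dirac_mass x u) (fun v => n v - a * dirac_mass y v)
    (fun u v => p u v - a * ((u == x)%:R * (v == y)%:R)).
Proof.
move=> [p0 pm pn] /andP [a0 ap]; split=> [u v|u|v].
- rewrite subr_ge0; have [->|_] := eqVneq u x; last by rewrite mul0r mulr0.
  by have [->|_] := eqVneq v y; rewrite ?mulr0 ?mulr1.
- rewrite sumrB pm -mulr_sumr -mulr_sumr; congr (_ - a * _).
  under eq_bigr => v _ do rewrite -[(v == y)%:R]mulr1.
  by rewrite sum_dirac mulr1.
- by rewrite sumrB pn -mulr_sumr (sum_dirac x (fun=> _)).
Qed.

(** If nothing is shipped from [x] to [y], couple the mass leaving [x]
    proportionally with the mass reaching [y]: a portion of the shipments
    [x -> v] and [u -> y] is replaced by shipments [u -> v], and [c] units of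
    mass disappear at [x] and at [y].  Entries stay nonnegative because
    [p x y = 0] keeps the two subtracted terms from falling on the same entry. *)
Lemma plan_reroute (m n : T -> R) p x y c : is_plan m n p -> p x y = 0 ->
  0 < c -> c <= m x -> c <= n y ->
  is_plan (fun u => m u - c * dirac_mass x u) (fun v => n v - c * dirac_mass y v)
    (fun u v => (p u v + - (c / m x * ((u == x)%:R * p x v))
                 + - (c / n y * ((v == y)%:R * p u y)))
                + c / (m x * n y) * (p u y * p x v)).
Proof.
move=> [p0 pm pn] pxy c0 cm cn.
have mx0 : 0 < m x := lt_le_trans c0 cm.
have ny0 : 0 < n y := lt_le_trans c0 cn.
have mxN := lt0r_neq0 mx0; have nyN := lt0r_neq0 ny0.
split=> [u v|u|v].
- have g0 : 0 <= c / (m x * n y) * (p u y * p x v).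
    by rewrite mulr_ge0 // ?divr_ge0 ?mulr_ge0 // ltW.
  have [ux|ux] := eqVneq u x; have [vy|vy] := eqVneq v y.
  + by rewrite ux vy pxy !(mulr0, subr0, addr0).
  + rewrite ux pxy !(mulr0, mul0r, subr0, addr0, mul1r).
    by rewrite subr_ge0 -{2}[p x v]mul1r ler_wpM2r // ler_pdivrMr // mul1r.
  + rewrite vy pxy !(mulr0, mul0r, subr0, addr0, mul1r).
    by rewrite subr_ge0 -{2}[p u y]mul1r ler_wpM2r // ler_pdivrMr // mul1r.
  + by rewrite !mul0r !mulr0 !subr0 addr_ge0.
- rewrite !big_split /= !sumrN pm -!mulr_sumr pm.
  rewrite (sum_dirac y (fun=> p u y)) /dirac_mass.
  by field; rewrite nyN mxN.
- rewrite !big_split /= !sumrN pn -!mulr_sumr.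
  rewrite (sum_dirac x (fun=> p x v)) -mulr_suml !pn /dirac_mass.
  by field; rewrite nyN mxN.
Qed.

(** By hypothesis every replacement of [u -> y] and [x -> v] by [u -> v] saves
    [t], and [c] units are replaced. *)
Lemma plan_reroute_cost m n p x y c t : is_plan m n p ->
  0 < c -> c <= m x -> c <= n y ->
  (forall u v, 0 < p u y -> 0 < p x v -> d u v + t <= d u y + d x v) ->
  plan_cost d (fun u v => (p u v + - (c / m x * ((u == x)%:R * p x v))
                 + - (c / n y * ((v == y)%:R * p u y)))
                + c / (m x * n y) * (p u y * p x v)) <= plan_cost d p - c * t.
Proof.
move=> [p0 pm pn] c0 cm cn H.
have mx0 : 0 < m x := lt_le_trans c0 cm.
have ny0 : 0 < n y := lt_le_trans c0 cn.
have mxN := lt0r_neq0 mx0; have nyN := lt0r_neq0 ny0.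
rewrite !plan_costD !plan_costN !plan_costZ plan_cost_row plan_cost_col.
set A := \sum_v _; set B := \sum_u _.
have le1 : plan_cost d (fun u v => p u y * p x v) <=
   \sum_u \sum_v (d u y * p u y * p x v + (d x v * p x v) * p u y
     - t * (p u y * p x v)).
  apply: ler_sum => u _; apply: ler_sum => v _.
  have := p0 u y; rewrite le_eqVlt => /orP [/eqP <-|puy]; first by lra.
  have := p0 x v; rewrite le_eqVlt => /orP [/eqP <-|pxv]; first by lra.
  have -> : d u y * p u y * p x v + d x v * p x v * p u y - t * (p u y * p x v)
    = (d u y + d x v - t) * (p u y * p x v) by ring.
  by rewrite ler_wpM2r ?mulr_ge0 // lerBrDr H.
have le2 : plan_cost d (fun u v => p u y * p x v) <=
    m x * B + n y * A - t * (n y * m x).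
  apply: le_trans le1 _; rewrite le_eqVlt; apply/orP; left; apply/eqP.
  under eq_bigr => u _ do
    rewrite sumrB big_split /= -mulr_sumr -mulr_suml -!mulr_sumr !pm.
  rewrite sumrB big_split /= -mulr_suml -!mulr_sumr -mulr_suml pn -/A -/B.
  by ring.
have cmn : 0 <= c / (m x * n y) by rewrite divr_ge0 ?mulr_ge0 ?ltW.
have := ler_wpM2l cmn le2.
have -> : c / (m x * n y) * (m x * B + n y * A - t * (n y * m x)) =
  c / n y * B + c / m x * A - c * t by field; rewrite mxN.
by lra.
Qed.

(** As much as possible of the mass [c] is taken from the direct shipment
    [x -> y], which saves [d x y >= t] per unit; once that shipment is exhausted,
    rerouting applies to the remainder. *)
Lemma transportable_cut m n x y c t K :
  transportable d m n K -> 0 <= c -> c <= m x -> c <= n y -> t <= d x y ->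
  (forall u v, 0 < m u -> 0 < n v -> u != x -> v != y ->
     d u v + t <= d u y + d x v) ->
  transportable d (fun u => m u - c * dirac_mass x u)
                  (fun v => n v - c * dirac_mass y v) (K - c * t).
Proof.
move=> [q qP qK] c0 cm cn txy H.
have [q0 qm qn] := qP.
have direct_cost a : plan_cost d (fun u v => q u v - a * ((u == x)%:R * (v == y)%:R))
    = plan_cost d q - a * d x y.
  rewrite plan_costD plan_costN plan_costZ plan_cost_row; congr (_ - _ * _).
  by rewrite -(sum_dirac y (d x)); apply: eq_bigr => v _; exact: mulrC.
have [le_cq|lt_qc] := leP c (q x y).
  exists (fun u v => q u v - c * ((u == x)%:R * (v == y)%:R)).
    by apply: plan_remove_direct; rewrite ?c0.
  by rewrite direct_cost; have := ler_wpM2l c0 txy; lra.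
set a := q x y in lt_qc.
have a0 : 0 <= a := q0 x y.
have aP : 0 <= a <= q x y by rewrite a0 lexx.
have rP := plan_remove_direct qP aP.
set r := (fun u v => q u v - a * ((u == x)%:R * (v == y)%:R)) in rP.
set m' := (fun u => m u - a * dirac_mass x u) in rP.
set n' := (fun u => n u - a * dirac_mass y u) in rP.
have rxy : r x y = 0 by rewrite /r !eqxx !mulr1 subrr.
have m'x : m' x = m x - a by rewrite /m' /dirac_mass eqxx mulr1.
have n'y : n' y = n y - a by rewrite /n' /dirac_mass eqxx mulr1.
have ca : 0 < c - a by rewrite subr_gt0.
have cm' : c - a <= m' x by rewrite m'x lerD2r.
have cn' : c - a <= n' y by rewrite n'y lerD2r.
have sP := plan_reroute rP rxy ca cm' cn'.
have r_le u v : r u v <= q u v.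
  by rewrite gerDl oppr_le0 !mulr_ge0 ?ler0n.
have H' u v : 0 < r u y -> 0 < r x v -> d u v + t <= d u y + d x v.
  move=> ru rv; apply: H.
  - exact: plan_pos_row qP (lt_le_trans ru (r_le _ _)).
  - exact: plan_pos_col qP (lt_le_trans rv (r_le _ _)).
  - by apply: contraTneq ru => ->; rewrite rxy ltxx.
  - by apply: contraTneq rv => ->; rewrite rxy ltxx.
have s_cost := plan_reroute_cost rP ca cm' cn' H'.
have [p0 pm pn] := sP.
eexists.
  split; first exact: p0.
    by move=> u; rewrite pm /m'; ring.
  by move=> v; rewrite pn /n'; ring.
apply: le_trans s_cost _.
rewrite direct_cost.
by have := ler_wpM2l a0 txy; lra.
Qed.

(** By the triangle inequality, mass common to source and target may stay in
    place: cut it off point by point, with [x = y] and no gain. *)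
Lemma transportable_cancel (s : seq T) m n K :
  (forall x y z, d x z <= d x y + d y z) -> (forall x, 0 <= d x x) ->
  (forall x, 0 <= m x) -> (forall x, 0 <= n x) ->
  transportable d (fun u => m u + \sum_(x <- s) dirac_mass x u)
                  (fun u => n u + \sum_(x <- s) dirac_mass x u) K ->
  transportable d m n K.
Proof.
move=> dtri d0 m0 n0; elim: s => [|x s IH].
  by apply: transportable_eq => u; rewrite big_nil addr0.
move=> H; apply: IH.
have s0 u : 0 <= \sum_(x <- s) dirac_mass x u by apply: sumr_ge0 => *; apply: ler0n.
have := transportable_cut (x := x) (y := x) (t := 0) H ler01.
rewrite !big_cons /dirac_mass eqxx mulr0 subr0 /= => /(_ _ _ (d0 x)) C.
apply: transportable_eq (C _ _ _) => [u|u|||u v _ _ _ _].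
- by rewrite big_cons; ring.
- by rewrite big_cons; ring.
- by have := m0 x; have := s0 x; rewrite /dirac_mass; lra.
- by have := n0 x; have := s0 x; rewrite /dirac_mass; lra.
- by rewrite addr0.
Qed.

End OneSpace.

Lemma pushforward_dirac (T T' : finType) (f : T -> T') (m : T -> R) z :
  pushforward f m z = \sum_a m a * dirac_mass (f a) z.
Proof.
rewrite /pushforward big_mkcond; apply: eq_bigr => a _.
by rewrite /dirac_mass eq_sym; case: ifP; rewrite ?mulr1 ?mulr0.
Qed.

Lemma transportable_push (T T' : finType) (f : T -> T') (d : T -> T -> R)
    (d' : T' -> T' -> R) m n c :
  (forall u v, d' (f u) (f v) <= d u v) -> transportable d m n c ->
  transportable d' (pushforward f m) (pushforward f n) c.
Proof.
move=> fd [p [p0 pm pn] pc].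
exists (fun a b => \sum_(u | f u == a) \sum_(v | f v == b) p u v).
  split=> [a b|a|b].
  - by apply: sumr_ge0 => u _; apply: sumr_ge0.
  - rewrite exchange_big; apply: eq_bigr => u _.
    by rewrite -pm [RHS](partition_big f predT).
  - transitivity (\sum_u \sum_(v | f v == b) p u v).
      by rewrite [RHS](partition_big f predT).
    by rewrite exchange_big; apply: eq_bigr => v _.
apply: le_trans pc; rewrite /plan_cost [leRHS](partition_big f predT) //.
apply: ler_sum => a _.
have -> : \sum_(u | f u == a) \sum_v d u v * p u v =
    \sum_b \sum_(u | f u == a) \sum_(v | f v == b) d u v * p u v.
  by rewrite [RHS]exchange_big; apply: eq_bigr => u _; rewrite [LHS](partition_big f predT).
apply: ler_sum => b _; rewrite mulr_sumr; apply: ler_sum => u /eqP <-.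
rewrite mulr_sumr; apply: ler_sum => v /eqP <-.
by rewrite ler_wpM2r.
Qed.

End Transport.

(** * Distances and balls in a graph *)

Section Distance.
Variables (T : finType) (e : rel T).

Lemma dist_le_size x p : path e x p -> (dist e x (last x p) <= size p)%N.
Proof.
move=> xp; rewrite /dist.
have [lt_pT|le_Tp] := ltnP (size p) #|T|; last first.
  by apply: leq_trans (find_size _ _) _; rewrite size_iota.
rewrite leqNgt; apply/negP => /(before_find 0%N).
rewrite nth_iota // add0n => /negbT/negP; apply; apply/existsP.
by exists (in_tuple p); rewrite xp eqxx.
Qed.

Lemma geodesic x y : connect e x y ->
  exists p, [/\ path e x p, last x p = y & size p = dist e x y].
Proof.
move=> /connectP [p /shortenP [q xq uq _] ->].
have lt_qT : (size q < #|T|)%N by have := max_card (mem (x :: q)); rewrite (card_uniqP uq).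
set z := last x q.
pose a k := [exists p : k.-tuple T, path e x p && (last x p == z)].
have ha : has a (iota 0 #|T|).
  apply/hasP; exists (size q); first by rewrite mem_iota.
  by apply/existsP; exists (in_tuple q); rewrite xq eqxx.
have := ha; rewrite has_find size_iota => lt_fT.
have := nth_find 0%N ha; rewrite nth_iota // add0n => /existsP [r /andP [xr /eqP rz]].
by exists r; rewrite size_tuple.
Qed.

Hypothesis hG : is_graph e.

Lemma graph_sym : symmetric e. Proof. by case: hG. Qed.
Lemma graph_irr x : e x x = false. Proof. by case: hG => _ ->. Qed.
Lemma graph_connect x y : connect e x y. Proof. by case: hG. Qed.

Lemma dist_refl x : dist e x x = 0%N.
Proof. by apply/eqP; rewrite -leqn0 (@dist_le_size x [::]). Qed.

Lemma dist_eq0 x y : dist e x y = 0%N -> x = y.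
Proof.
have [p [_ <- <-]] := geodesic (graph_connect x y).
by move/eqP/nilP => ->.
Qed.

Lemma dist_tri x y z : (dist e x z <= dist e x y + dist e y z)%N.
Proof.
have [p [xp py <-]] := geodesic (graph_connect x y).
have [q [yq qz <-]] := geodesic (graph_connect y z).
rewrite -qz -py -last_cat -size_cat; apply: dist_le_size.
by rewrite cat_path xp py.
Qed.

Lemma dist_edge x y : e x y -> dist e x y = 1%N.
Proof.
move=> exy; apply/eqP; rewrite eqn_leq (@dist_le_size x [:: y]) /= ?exy //.
by rewrite lt0n; apply: contraTneq exy => /dist_eq0 ->; rewrite graph_irr.
Qed.

Lemma dist_first_step x y : (0 < dist e x y)%N ->
  exists2 z, e x z & dist e x y = (dist e z y).+1.
Proof.
have [[|z p] [/= xp py pd]] := geodesic (graph_connect x y).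
  by rewrite -pd.
move=> _; have [xz zp] := andP xp; exists z => //.
have := dist_le_size zp; rewrite py => le1.
have := dist_tri x z y; rewrite (dist_edge xz) => le2.
by apply/eqP; rewrite eqn_leq le2 -pd ltnS.
Qed.

Lemma dist_ge2 x y : y != x -> ~~ e x y -> (2 <= dist e x y)%N.
Proof.
case E: (dist e x y) => [|[|k]] //.
  by rewrite (dist_eq0 E) eqxx.
have [|z xz] := @dist_first_step x y; first by rewrite E.
by rewrite E => -[/esym /dist_eq0 <-]; rewrite xz.
Qed.

Lemma dist_le_diam x y : (dist e x y <= diam e)%N.
Proof. by apply: leq_trans (leq_bigmax _) (leq_bigmax x). Qed.

Lemma diam_attained : exists x y, dist e x y = diam e.
Proof.
have [_ _ _ [x0 [_ _]]] := hG.
have T0 : (0 < #|T|)%N by apply/card_gt0P; exists x0.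
have [x xP] := @bigop.eq_bigmax T (fun x => \max_y dist e x y)%N T0.
have [y yP] := @bigop.eq_bigmax T (fun y => dist e x y) T0.
by exists x, y; rewrite /diam xP yP.
Qed.

Lemma diam_gt0 : (0 < diam e)%N.
Proof.
have [_ _ _ [x [y xy]]] := hG.
by apply: leq_trans (dist_le_diam x y); rewrite dist_edge.
Qed.

Lemma regular_gt0 D : regular e D -> (0 < D)%N.
Proof.
have [_ _ _ [x [y xy]]] := hG => hD.
by rewrite -(hD x); apply/card_gt0P; exists y; rewrite inE.
Qed.

Variable R : realType.

Definition rdist x y : R := (dist e x y)%:R.

Definition ball x : T -> R := fun y => ((y == x) || e x y)%:R.

Lemma ball_ge0 x y : 0 <= ball x y. Proof. exact: ler0n. Qed.

Lemma sum_ball x (F : T -> R) :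
  \sum_y ball x y * F y = F x + \sum_(y | e x y) F y.
Proof.
rewrite (bigD1 x) //= /ball eqxx mul1r; congr (_ + _).
rewrite [RHS]big_mkcond [RHS](bigD1 x) //= graph_irr add0r.
by apply: eq_bigr => y /negPf ->; case: (e x y); rewrite ?mul1r ?mul0r.
Qed.

Lemma regular_sum1 D x : regular e D -> \sum_(y | e x y) (1 : R) = D%:R.
Proof.
move=> hD; rewrite sumr_const -(hD x); congr (_ *+ _).
by apply: eq_card => y; rewrite !inE.
Qed.

Lemma ball_mass D x : regular e D -> \sum_y ball x y = D.+1%:R.
Proof.
move=> hD; under eq_bigr => y _ do rewrite -[ball x y]mulr1.
by rewrite (sum_ball x (fun=> 1)) (regular_sum1 x hD) -natr1 addrC.
Qed.

Lemma mu_ball D x : mu R e D x =1 fun y => D.+1%:R^-1 * ball x y.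
Proof. by move=> y; rewrite /mu /ball; case: ifP; rewrite ?mulr1 ?mulr0. Qed.

Lemma rdist_tri x y z : rdist x z <= rdist x y + rdist y z.
Proof. by rewrite /rdist -natrD ler_nat dist_tri. Qed.

Lemma rdist_refl x : rdist x x = 0. Proof. by rewrite /rdist dist_refl. Qed.

(** Extra mass [k] at the two ends of an edge adds exactly [k] to the cost.
    After the common part [C] of the balls is cancelled, the source consists of
    the mass [k] at [x] and of neighbours [u] of [x] at distance at least 2 from
    [y].  Replacing [u -> y] and [x -> v] by [u -> v] then saves 1, since
    [d u v <= 1 + d x v], so the mass [k] can be cut off at both ends. *)
Lemma lazy_ball_transport x y k c : e x y -> 0 <= k ->
  transportable rdist (fun u => ball x u + k * dirac_mass R x u)
     (fun u => ball y u + k * dirac_mass R y u) (c + k) <->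
  transportable rdist (ball x) (ball y) c.
Proof.
move=> xy k0; split; last first.
  move=> H; rewrite -[k in c + k]mulr1; apply: transportableD => //.
  apply: transportableZ => //.
  have <- : rdist x y = 1 by rewrite /rdist dist_edge.
  exact: transportable_dirac.
set C := [set u in T | ((u == x) || e x u) && ((u == y) || e y u)]%SET.
pose A u : R := (((u == x) || e x u) && (u \notin C))%:R.
pose B u : R := (((u == y) || e y u) && (u \notin C))%:R.
have sC u : \sum_(z <- enum C) dirac_mass R z u = (u \in C)%:R.
  rewrite big_enum /= (eq_bigr (fun z => (z == u)%:R)); last first.
    by move=> z _; rewrite /dirac_mass eq_sym.
  rewrite big_mkcond -(sum_dirac u (fun z => (z \in C)%:R)).
  apply: eq_bigr => z _; case: ifP; rewrite ?mulr1 ?mulr0 //.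
have AE u : ball x u = A u + (u \in C)%:R.
  rewrite /ball /A !inE; case: (_ || _); case: (_ || _);
  by rewrite ?addr0 ?add0r.
have BE u : ball y u = B u + (u \in C)%:R.
  rewrite /ball /B !inE; case: (_ || _); case: (_ || _);
  by rewrite ?addr0 ?add0r.
have A0 u : 0 <= A u by apply: ler0n.
have B0 u : 0 <= B u by apply: ler0n.
have D0 u v : 0 <= k * dirac_mass R u v by rewrite mulr_ge0 ?ler0n.
move=> H.
have {}H : transportable rdist (fun u => A u + k * dirac_mass R x u)
     (fun u => B u + k * dirac_mass R y u) (c + k).
  apply: (transportable_cancel (s := enum C)) => [||u|u|].
  - exact: rdist_tri.
  - by move=> u; rewrite rdist_refl.
  - by rewrite addr_ge0.
  - by rewrite addr_ge0.
  - by apply: transportable_eq H => u; rewrite sC ?AE ?BE; ring.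
have {}H : transportable rdist A B c.
  have := transportable_cut (x := x) (y := y) (t := 1) H k0.
  rewrite /dirac_mass !eqxx /= !mulr1 !lerDr addrK => /(_ (A0 _) (B0 _)).
  rewrite {1}/rdist (dist_edge xy) => /(_ (lexx _)) C0.
  apply: transportable_eq (C0 _) => [u|u|u v Au _ ux vy].
  - by rewrite addrK.
  - by rewrite addrK.
  move: Au; rewrite (negPf ux) mulr0 addr0 /A !inE (negPf ux) /=.
  case xu: (e x u) => /=; last by rewrite ltxx.
  case uy: (_ || _); rewrite ?ltxx // => _.
  have [ny nyu] := norP (negbT uy).
  have : 2 <= rdist u y by rewrite /rdist ler_nat dist_ge2 1?eq_sym // graph_sym.
  have := rdist_tri u x v.
  have -> : rdist u x = 1 by rewrite /rdist dist_edge // graph_sym.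
  lra.
have := transportableD H
  (transportable_refl (m := fun u => (u \in C)%:R) (fun _ => ler0n _ _) rdist_refl).
by rewrite addr0; apply: transportable_eq => u; rewrite ?AE ?BE.
Qed.

End Distance.

(** * Curvature and the Bonnet-Myers inequality *)

Section Sharpness.
Variables (R : realType) (T : finType) (e : rel T).

Definition is_prob (m : T -> R) := (forall x, 0 <= m x) /\ \sum_x m x = 1.

(** The [eps] stands for the gap between the infimum and the cost of a coupling;
    the product coupling shows that the infimum is over a nonempty set. *)
Lemma W1_transportable m n c : is_prob m -> is_prob n ->
  W1 e m n <= c <->
  forall eps, 0 < eps -> transportable (rdist e R) m n (c + eps).
Proof.
move=> [m0 m1] [n0 n1]; split=> [Wc eps eps0|H].
  have : W1 e m n < c + eps by apply: le_lt_trans Wc _; rewrite ltrDl.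
  move=> /inf_lt [|_ [p [p01 pm pn] <-] /ltW pc]; last first.
    by exists p => //; split=> // u v; case/andP: (p01 u v).
  have pm u : \sum_v m u * n v = m u by rewrite -mulr_sumr n1 mulr1.
  exists (\sum_u \sum_v (dist e u v)%:R * (m u * n v)), (fun u v => m u * n v).
  - split=> // [u v|v]; last by rewrite -mulr_suml m1 mul1r.
    rewrite mulr_ge0 //= mulr_ile1 //.
      by rewrite -m1 (bigD1 u) //= lerDl sumr_ge0.
    by rewrite -n1 (bigD1 v) //= lerDl sumr_ge0.
  - by [].
apply/ler_addgt0Pr => eps /H [p [p0 pm pn] pc].
apply: le_trans pc; apply: ge_inf.
  exists 0 => _ [q [q01 _ _] <-]; apply: sumr_ge0 => u _; apply: sumr_ge0 => v _.
  by rewrite mulr_ge0 ?ler0n //; case/andP: (q01 u v).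
exists p => //; split=> // u v; rewrite p0 /=.
have mu_le1 : m u <= 1 by rewrite -m1 (bigD1 u) //= lerDl sumr_ge0.
by apply: le_trans mu_le1; rewrite -pm (bigD1 v) //= lerDl sumr_ge0.
Qed.

Hypothesis hG : is_graph e.
Variable D : nat.
Hypothesis hD : regular e D.

Lemma mu_prob x : is_prob (mu R e D x).
Proof.
split=> [y|]; first by rewrite mu_ball mulr_ge0 ?ball_ge0 // invr_ge0 ler0n.
under eq_bigr => y _ do rewrite mu_ball.
by rewrite -mulr_sumr (ball_mass hG _ x hD) mulVf // pnatr_eq0.
Qed.

Lemma mu_ball_transportable x y c :
  transportable (rdist e R) (mu R e D x) (mu R e D y) c <->
  transportable (rdist e R) (ball e R x) (ball e R y) (D.+1%:R * c).
Proof.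
have D1 : D.+1%:R != 0 :> R by rewrite pnatr_eq0.
split=> [H|H].
  apply: transportable_eq (transportableZ (ler0n R D.+1) H) => u;
  by rewrite mu_ball mulrA divff // mul1r.
have Dinv : 0 <= D.+1%:R^-1 :> R by rewrite invr_ge0 ler0n.
rewrite -[c]mul1r -(mulVf D1) -mulrA.
by apply: transportable_eq (transportableZ Dinv H) => u; rewrite mu_ball.
Qed.

(** An edge has length 1, so the curvature bound says that the Wasserstein
    distance is at most [1 - t D / (D + 1)]; multiplying by [D + 1] turns the
    uniform measures into ball measures and removes the denominators. *)
Lemma kappa_ge x y t : e x y ->
  t <= kappa R e D x y <->
  forall eps, 0 < eps -> transportable (rdist e R) (ball e R x) (ball e R y)
    (D.+1%:R - t * D%:R + eps).
Proof.
move=> xy.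
have D0 : 0 < D%:R :> R by rewrite ltr0n (regular_gt0 hG hD).
have D1 : 0 < D.+1%:R :> R by rewrite ltr0n.
have -> : (t <= kappa R e D x y) =
    (W1 e (mu R e D x) (mu R e D y) <= 1 - t * D%:R / D.+1%:R).
  rewrite /kappa (dist_edge hG xy) divr1 mulrAC ler_pdivlMr //.
  by rewrite -ler_pdivrMl // [D.+1%:R^-1 * _]mulrC lerBrDr addrC -lerBrDr.
rewrite (W1_transportable _ (mu_prob x) (mu_prob y)).
have E eps : D.+1%:R * (1 - t * D%:R / D.+1%:R + eps) =
    D.+1%:R - t * D%:R + D.+1%:R * eps
  by move: D.+1%:R (lt0r_neq0 D1) => X X0; field.
split=> H eps eps0.
  have /H/mu_ball_transportable : 0 < eps / D.+1%:R by rewrite divr_gt0.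
  by rewrite E mulrCA divff ?mulr1 // lt0r_neq0.
by apply/mu_ball_transportable; rewrite E; apply: H; rewrite mulr_gt0.
Qed.

(** Let [x] and [y] be at maximal distance [L] and test with the 1-Lipschitz
    function [d x].  Its sum over a ball grows by at most [D + 1 - t D] along
    each edge of a geodesic from [x] to [y].  It is [D] over the ball around
    [x], and at least [L + D (L - 1)] over the ball around [y], whose points
    have distance at least [L - 1] from [x]. *)
Lemma bonnet_myers t :
  (forall x y, e x y -> t <= kappa R e D x y) -> t <= 2 / (diam e)%:R.
Proof.
move=> H; have [x [y xyL]] := diam_attained hG.
pose f z : R := rdist e R x z.
pose ball_sum z := \sum_u ball e R z u * f u.
have f_lip u v : f v - f u <= rdist e R u v.
  by rewrite lerBlDl (rdist_tri hG).
have step u v : e u v -> ball_sum v - ball_sum u <= D.+1%:R - t * D%:R.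
  move=> uv; apply/ler_addgt0Pr => eps eps0.
  by apply: transportable_lipschitz f_lip _; apply: (kappa_ge t uv).1 => //; apply: H.
have [p [xp py pL]] := geodesic (graph_connect hG x y).
have chain q u : path e u q ->
    ball_sum (last u q) - ball_sum u <= (size q)%:R * (D.+1%:R - t * D%:R).
  elim: q u => [|v q IH] u /=; first by rewrite subrr mul0r.
  move=> /andP [uv vq]; have := step _ _ uv; have := IH _ vq.
  by rewrite -[(size q).+1%:R]natr1 mulrDl mul1r; lra.
have sum_x : ball_sum x = D%:R.
  rewrite /ball_sum (sum_ball hG) /f rdist_refl add0r -(regular_sum1 R x hD).
  by apply: eq_bigr => z xz; rewrite /rdist (dist_edge hG xz).
have sum_y : (diam e)%:R * D.+1%:R - D%:R <= ball_sum y.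
  rewrite /ball_sum (sum_ball hG) /f.
  have : \sum_(z | e y z) ((diam e)%:R - 1) <= \sum_(z | e y z) rdist e R x z.
    apply: ler_sum => z yz; rewrite lerBlDr -xyL.
    apply: le_trans (rdist_tri hG R x z y) _; rewrite lerD2l /rdist.
    by rewrite (dist_edge hG) // graph_sym.
  have -> : \sum_(z | e y z) ((diam e)%:R - 1) = ((diam e)%:R - 1) * D%:R :> R.
    by rewrite -(regular_sum1 R y hD) mulr_sumr; apply: eq_bigr => *; rewrite mulr1.
  by rewrite [X in _ <= X + _]/rdist xyL -natr1; lra.
have L0 : 0 < (diam e)%:R :> R by rewrite ltr0n (diam_gt0 hG).
have D0 : 0 < D%:R :> R by rewrite ltr0n (regular_gt0 hG hD).
rewrite ler_pdivlMr // -(ler_pM2r D0).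
by move: (chain _ _ xp); rewrite py sum_x pL xyL; lra.
Qed.

(** The infimum over the edges is a minimum, and [bonnet_myers] gives the
    inequality that is missing from the equality in the definition. *)
Lemma sharpP :
  bonnet_myers_sharp R e <->
  forall x y, e x y -> 2 / (diam e)%:R <= kappa R e D x y.
Proof.
have [_ _ _ [x0 [y0 e0]]] := hG.
pose q0 : T * T := (x0, y0).
pose k (q : T * T) : R := kappa R e D q.1 q.2.
case: (arg_minP k (i0 := q0) (P := fun q => e q.1 q.2) e0) => q eq qmin.
set S := [set kappa R e D q.1 q.2 | q in [set q : T * T | e q.1 q.2]]%classic.
have infS : inf S = k q.
  apply/eqP; rewrite eq_le; apply/andP; split.
    by apply: ge_inf; [exists (k q) => _ [r er <-]; apply: qmin | exists q].
  by apply: lb_le_inf; [exists (k q), q | move=> _ [r er <-]; apply: qmin].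
split=> [[D' hD' sharp] x y xy|H].
  have DD : D' = D by rewrite -(hD' x0) (hD x0).
  by move: sharp; rewrite DD -/S infS => <-; apply: (qmin (x, y)).
exists D => //; rewrite -/S infS; apply/eqP; rewrite eq_le (H _ _ eq) andbT.
by apply: bonnet_myers => x y xy; apply: (qmin (x, y)).
Qed.

End Sharpness.

(** * Cartesian products *)

Section Product.
Variables (N : nat) (V : 'I_N -> finType).
Local Notation X := {dffun forall i : 'I_N, V i}.

Definition upd (x : X) i (a : V i) : X := [ffun j => dfwith x a j].

Lemma upd_same x i a : @upd x i a i = a.
Proof. by rewrite ffunE dfwith_in. Qed.

Lemma upd_other x i a j : j != i -> @upd x i a j = x j.
Proof. by move=> ji; rewrite ffunE dfwith_out // eq_sym. Qed.

Lemma upd_ext (x y : X) i : (forall j, j != i -> x j = y j) -> upd x (y i) = y.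
Proof.
move=> H; apply/ffunP => j; have [->|ji] := eqVneq j i; first exact: upd_same.
by rewrite upd_other // H.
Qed.

Lemma upd_id x i : upd x (x i) = x.
Proof. exact: upd_ext. Qed.

Lemma upd_upd x i (a b : V i) : upd (upd x a) b = upd x b.
Proof.
rewrite -{1}(upd_same x b).
by apply: upd_ext => j ji; rewrite !upd_other.
Qed.

Variable E : forall i, rel (V i).
Arguments E : clear implicits.
Hypothesis hG : forall i, is_graph (E i).

Lemma cart_prod_upd (x : X) i a : E i (x i) a -> cart_prod E x (upd x a).
Proof.
move=> xa; apply/existsP; exists i; rewrite upd_same xa andbT.
apply/forallP => j; have [->|ji] := eqVneq j i; last first.
  by rewrite upd_other // eqxx.
rewrite upd_same eqb_id; apply: contraTneq xa => <-.
by rewrite (graph_irr (hG i)).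
Qed.

Lemma cart_prodP (x y : X) :
  reflect (exists i, exists2 a, E i (x i) a & y = upd x a) (cart_prod E x y).
Proof.
apply: (iffP existsP) => [[i /andP [/forallP H xy]]|[i [a xa ->]]]; last first.
  by have /existsP := cart_prod_upd xa.
exists i, (y i) => //; apply/esym/upd_ext => j ji.
by apply/eqP; have := H j; rewrite (negPf ji) eqbF_neg negbK.
Qed.

(** A neighbour differs from [x] in exactly one coordinate [i], so the
    neighbours are counted once each by the pairs of [i] and a neighbour of
    [x i]. *)
Lemma big_cart_prod (S : Type) (idx : S) (op : Monoid.com_law idx) (x : X) (F : X -> S) :
  \big[op/idx]_(y | cart_prod E x y) F y =
  \big[op/idx]_i \big[op/idx]_(a | E i (x i) a) F (upd x a).
Proof.
pose P i (y : X) := (upd x (y i) == y) && E i (x i) (y i).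
have inner i : \big[op/idx]_(a | E i (x i) a) F (upd x a) =
    \big[op/idx]_(y | P i y) F y.
  rewrite [RHS](reindex_onto (fun a => upd x a) (fun y : X => y i)); last first.
    by move=> y /andP [/eqP].
  by apply: eq_bigl => a; rewrite /P upd_same !eqxx andbT.
under [RHS]eq_bigr => i _ do rewrite inner big_mkcond.
rewrite exchange_big big_mkcond; apply: eq_bigr => y _.
rewrite -big_mkcond; case: ifP => [/cart_prodP [i [a xa ->]]|xy].
  rewrite (big_pred1 i) // => j; rewrite /P.
  have [->|ji] := eqVneq j i; first by rewrite upd_same xa /= !eqxx.
  by rewrite upd_other // (graph_irr (hG j)) andbF /= (negPf ji).
rewrite big_pred0 // => i; apply: contraFF xy => /andP [/eqP Py xy'].
by rewrite -Py; apply: cart_prod_upd.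
Qed.

Lemma cart_prod_regular D : (forall i, regular (E i) (D i)) ->
  regular (cart_prod E) (\sum_i D i)%N.
Proof.
move=> hD x; rewrite -sum1_card.
rewrite (eq_bigl (cart_prod E x)); last by move=> y; rewrite inE.
rewrite big_cart_prod; apply: eq_bigr => i _; rewrite sum1_card -(hD i (x i)).
by apply: eq_card => a; rewrite inE.
Qed.

Lemma sum_dist_upd_le (x : X) i a (y : X) : E i (x i) a ->
  (\sum_j dist (E j) (x j) (y j) <= (\sum_j dist (E j) (upd x a j) (y j)).+1)%N.
Proof.
move=> xa; rewrite (bigD1 i) //= [X in (_ <= X.+1)%N](bigD1 i) //= -addSn.
rewrite upd_same leq_add //.
  by apply: leq_trans (dist_tri (hG i) _ a _) _; rewrite (dist_edge (hG i) xa).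
by apply: leq_sum => j ji; rewrite upd_other.
Qed.

(** As long as some coordinate is not yet right, a first step of a geodesic of
    that factor lowers the sum of the distances by 1. *)
Lemma cart_prod_path (x y : X) :
  exists p, [/\ path (cart_prod E) x p, last x p = y
    & size p = (\sum_i dist (E i) (x i) (y i))%N].
Proof.
move: {2}(\sum_i _)%N (erefl (\sum_i dist (E i) (x i) (y i))%N) => n.
elim: n x => [|n IH] x En.
  exists [::]; split=> //=; apply/ffunP => i; apply: (dist_eq0 (hG i)).
  by apply/eqP; move/eqP: En; rewrite sum_nat_eq0 => /forallP /(_ i).
have [i di] : exists i, (0 < dist (E i) (x i) (y i))%N.
  apply/existsP; apply: contra_eqT En => /existsPn H.
  by rewrite big1 // => i _; apply/eqP; rewrite -leqn0 leqNgt H.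
have [a xa da] := dist_first_step (hG i) di.
have Ea : (\sum_j dist (E j) (upd x a j) (y j))%N = n.
  apply/eqP; rewrite -eqSS -En (bigD1 i) //= [X in _ == X](bigD1 i) //= da upd_same.
  rewrite addSn; apply/eqP; congr (_ + _).+1.
  by apply: eq_bigr => j ji; rewrite upd_other.
have [p [xp py ps]] := IH _ Ea.
exists (upd x a :: p); split=> //=; first by rewrite cart_prod_upd.
by rewrite ps Ea En.
Qed.

Lemma cart_prod_graph : (0 < N)%N -> is_graph (cart_prod E).
Proof.
move=> hN; split.
- suff H (x y : X) : cart_prod E x y -> cart_prod E y x.
    by move=> x y; apply/idP/idP; apply: H.
  move=> /cart_prodP [i [a xa ->]].
  rewrite -[X in cart_prod _ _ X](upd_id x i) -(upd_upd x a (x i)).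
  by apply: cart_prod_upd; rewrite upd_same (graph_sym (hG i)).
- move=> x; apply/negbTE/negP => /cart_prodP [i [a xa /(congr1 (fun z : X => z i))]].
  by rewrite upd_same => xi; move: xa; rewrite -xi (graph_irr (hG i)).
- by move=> x y; have [p [xp <- _]] := cart_prod_path x y; apply/connectP; exists p.
have v i : {a : V i | exists b, E i a b} by apply: cid; case: (hG i).
pose x : X := [ffun i => sval (v i)].
pose i0 := Ordinal hN; have [b ab] := svalP (v i0).
by exists x, (upd x b); apply: cart_prod_upd; rewrite ffunE.
Qed.

Lemma cart_prod_dist (hN : (0 < N)%N) (x y : X) :
  dist (cart_prod E) x y = (\sum_i dist (E i) (x i) (y i))%N.
Proof.
apply/eqP; rewrite eqn_leq; apply/andP; split.
  by have [p [xp <- <-]] := cart_prod_path x y; apply: dist_le_size.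
have [p [xp <- <-]] := geodesic (graph_connect (cart_prod_graph hN) x y).
elim: p x xp {y} => [|z p IH] x /=.
  by rewrite big1 // => i _; rewrite dist_refl.
move=> /andP [/cart_prodP [i [a xa ->]] zp].
by apply: leq_trans (sum_dist_upd_le _ xa) _; rewrite ltnS; apply: IH.
Qed.

Lemma cart_prod_diam (hN : (0 < N)%N) :
  diam (cart_prod E) = (\sum_i diam (E i))%N.
Proof.
apply/eqP; rewrite eqn_leq; apply/andP; split.
  apply/bigmax_leqP => x _; apply/bigmax_leqP => y _.
  rewrite cart_prod_dist //; apply: leq_sum => i _; exact: dist_le_diam.
have far i : {q : V i * V i | dist (E i) q.1 q.2 = diam (E i)}.
  by apply: cid; have [a [b ab]] := diam_attained (hG i); exists (a, b).
pose x : X := [ffun i => (sval (far i)).1].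
pose y : X := [ffun i => (sval (far i)).2].
apply: leq_trans (dist_le_diam _ x y); rewrite cart_prod_dist //.
by apply: leq_sum => i _; rewrite !ffunE (svalP (far i)).
Qed.

Variable R : realType.

(** A neighbour that differs from [x] in another coordinate than [i] projects to
    [x i]; this is where the extra mass comes from. *)
Lemma ball_proj (hN : (0 < N)%N) D (hD : forall i, regular (E i) (D i)) (x : X) i :
  pushforward (fun z : X => z i) (ball (cart_prod E) R x) =1
  (fun b => ball (E i) R (x i) b
     + (\sum_(j | j != i) D j)%:R * dirac_mass R (x i) b).
Proof.
move=> b; rewrite pushforward_dirac (sum_ball (cart_prod_graph hN)) big_cart_prod.
rewrite (bigD1 i) //= addrA; congr (_ + _).
  transitivity (\sum_a ball (E i) R (x i) a * dirac_mass R a b).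
    rewrite (sum_ball (hG i)); congr (_ + _).
    by apply: eq_bigr => a _; rewrite upd_same.
  rewrite -(sum_dirac b (ball (E i) R (x i))); apply: eq_bigr => a _.
  by rewrite mulrC /dirac_mass eq_sym.
rewrite natr_sum mulr_suml; apply: eq_bigr => j ji.
rewrite -(regular_sum1 R (x j) (hD j)) mulr_suml; apply: eq_bigr => a _.
by rewrite mul1r upd_other // eq_sym.
Qed.

Lemma ball_cart_prod (hN : (0 < N)%N) (x : X) i z :
  ball (cart_prod E) R x z =
  pushforward (fun b => upd x b) (ball (E i) R (x i)) z
  + \sum_(j | j != i) \sum_(b | E j (x j) b) dirac_mass R (upd x b) z.
Proof.
rewrite -(sum_dirac z (ball (cart_prod E) R x)).
under eq_bigr => y _ do rewrite mulrC -/(dirac_mass R z y) /dirac_mass eq_sym.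
rewrite (sum_ball (cart_prod_graph hN) x (fun y => (z == y)%:R)) big_cart_prod.
rewrite (bigD1 i) //= addrA; congr (_ + _).
by rewrite pushforward_dirac (sum_ball (hG i)) upd_id.
Qed.

(** Projection to coordinate [i] does not increase distances and yields the balls
    with extra mass, which gives one direction.  In the other, the line through
    [x] in direction [i] carries the given plan, and each neighbour [upd x b]
    of [x] off that line is shipped to the neighbour [upd (upd x a) b] of
    [upd x a] facing it. *)
Lemma cart_prod_transport (hN : (0 < N)%N) D
    (hD : forall i, regular (E i) (D i)) (x : X) i (a : V i) c : E i (x i) a ->
  transportable (rdist (cart_prod E) R)
    (ball (cart_prod E) R x) (ball (cart_prod E) R (upd x a))
    (c + (\sum_(j | j != i) D j)%:R) <->
  transportable (rdist (E i) R) (ball (E i) R (x i)) (ball (E i) R a) c.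
Proof.
move=> xa; split=> H.
  apply/(lazy_ball_transport (hG i) c xa (ler0n R (\sum_(j | j != i) D j))).
  have proj_le (u v : X) : rdist (E i) R (u i) (v i) <= rdist (cart_prod E) R u v.
    by rewrite ler_nat cart_prod_dist // (bigD1 i) //= leq_addr.
  apply: transportable_eq (transportable_push proj_le H) => b;
  by rewrite (ball_proj hN hD) ?upd_same.
have line_le (b b' : V i) :
    rdist (cart_prod E) R (upd x b) (upd x b') <= rdist (E i) R b b'.
  rewrite ler_nat cart_prod_dist // (bigD1 i) //= !upd_same big1 ?addn0 //.
  by move=> j ji; rewrite !upd_other // dist_refl.
have other : transportable (rdist (cart_prod E) R)
    (fun z => \sum_(j | j != i) \sum_(b | E j (x j) b) dirac_mass R (upd x b) z)
    (fun z => \sum_(j | j != i) \sum_(b | E j (upd x a j) b)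
                dirac_mass R (upd (upd x a) b) z)
    (\sum_(j | j != i) D j)%:R.
  rewrite natr_sum; apply: transportable_sum => j ji; rewrite upd_other //.
  rewrite -(regular_sum1 R (x j) (hD j)); apply: transportable_sum => b xb.
  have edge : cart_prod E (upd x b) (upd (upd x a) b).
    have -> : upd (upd x a) b = upd (upd x b) a.
      apply/ffunP => k; have [->|ki] := eqVneq k i.
        by rewrite upd_other ?upd_same // eq_sym.
      have [->|kj] := eqVneq k j; first by rewrite upd_same upd_other ?upd_same.
      by rewrite !upd_other.
    by apply: cart_prod_upd; rewrite upd_other // eq_sym.
  have <- : rdist (cart_prod E) R (upd x b) (upd (upd x a) b) = 1.
    by rewrite /rdist (dist_edge (cart_prod_graph hN) edge).
  exact: transportable_dirac.
apply: transportable_eq (transportableD (transportable_push line_le H) other) => z.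
  by rewrite (ball_cart_prod hN x i).
rewrite (ball_cart_prod hN (upd x a) i) upd_same; congr (pushforward _ _ _ + _).
by apply/funext => b; rewrite upd_upd.
Qed.

Lemma cart_prod_kappa (hN : (0 < N)%N) D
    (hD : forall i, regular (E i) (D i)) (x : X) i (a : V i) t : E i (x i) a ->
  t <= kappa R (cart_prod E) (\sum_i D i) x (upd x a) <->
  t * (\sum_i D i)%:R / (D i)%:R <= kappa R (E i) (D i) (x i) a.
Proof.
move=> xa.
rewrite (kappa_ge (cart_prod_graph hN) (cart_prod_regular hD) t (cart_prod_upd xa)).
rewrite (kappa_ge (hG i) (hD i) _ xa).
have Di0 : (D i)%:R != 0 :> R by rewrite pnatr_eq0 -lt0n (regular_gt0 (hG i) (hD i)).
rewrite divfK //.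
have E0 eps : (\sum_i D i).+1%:R - t * (\sum_i D i)%:R + eps =
   (D i).+1%:R - t * (\sum_i D i)%:R + eps + (\sum_(j | j != i) D j)%:R :> R.
  rewrite -[(\sum_i D i).+1%:R]natr1 -[(D i).+1%:R]natr1.
  by rewrite [in X in X + 1](bigD1 i) //= natrD; ring.
by split=> H eps /H; rewrite E0 cart_prod_transport.
Qed.

End Product.

Theorem theorem3p2 (R : realType) (N : nat) (hN : (0 < N)%N)
    (V : 'I_N -> finType) (E : forall i : 'I_N, rel (V i))
    (D L : 'I_N -> nat)
    (hG : forall i, is_graph (E i))
    (hD : forall i, regular (E i) (D i))
    (hL : forall i, diam (E i) = L i) :
  bonnet_myers_sharp R (cart_prod E) <->
  (forall i, bonnet_myers_sharp R (E i)) /\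
  (forall i j, (D i)%:R / (L i)%:R = (D j)%:R / (L j)%:R :> R).
Proof.
have D0 i : 0 < (D i)%:R :> R by rewrite ltr0n (regular_gt0 (hG i) (hD i)).
have L0 i : 0 < (L i)%:R :> R by rewrite ltr0n -hL (diam_gt0 (hG i)).
have i0 := Ordinal hN.
have sum0 (F : 'I_N -> nat) : (forall i, 0 < (F i)%:R :> R) -> 0 < (\sum_i F i)%:R :> R.
  by move=> F0; rewrite (bigD1 i0) //= natrD ltr_pwDl.
have DG0 := sum0 D D0; have LG0 := sum0 L L0.
have EL : diam (cart_prod E) = (\sum_i L i)%N.
  by rewrite cart_prod_diam //; apply: eq_bigr => i _; rewrite hL.
have sharpG : bonnet_myers_sharp R (cart_prod E) <-> forall i a b, E i a b ->
    2 / (\sum_i L i)%:R * (\sum_i D i)%:R / (D i)%:R <= kappa R (E i) (D i) a b.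
  rewrite (sharpP R (cart_prod_graph hG hN) (cart_prod_regular hG hD)) EL.
  split=> [H i a b ab|H x y /(cart_prodP hG) [i [a xa ->]]].
    have v j : {c : V j | exists d, E j c d} by apply: cid; case: (hG j).
    pose x : {dffun forall j, V j} := upd [ffun j => sval (v j)] a.
    have xi : x i = a by rewrite upd_same.
    have xb : E i (x i) b by rewrite xi.
    by rewrite -{1}xi; apply/(cart_prod_kappa hG hN hD _ xb)/H/cart_prod_upd.
  by apply/(cart_prod_kappa hG hN hD _ xa)/H.
rewrite sharpG; split=> [H|[sharp ratio] i a b ab]; last first.
  have := (sharpP R (hG i) (hD i)).1 (sharp i) a b ab; rewrite hL.
  apply: le_trans; rewrite le_eqVlt; apply/orP; left; apply/eqP.
  have cross : (D i)%:R * (\sum_i L i)%:R = (\sum_i D i)%:R * (L i)%:R :> R.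
    rewrite !natr_sum mulr_sumr mulr_suml; apply: eq_bigr => j _.
    by apply/eqP; rewrite -eqr_div ?lt0r_neq0 // (ratio i j).
  have -> : (\sum_i D i)%:R = (D i)%:R * (\sum_i L i)%:R / (L i)%:R :> R.
    by rewrite cross mulfK ?lt0r_neq0.
  by field; rewrite !lt0r_neq0.
have cross_le i : (L i)%:R * (\sum_i D i)%:R <= (\sum_i L i)%:R * (D i)%:R :> R.
  have := bonnet_myers (hG i) (hD i) (H i); rewrite hL.
  have -> : 2 / (\sum_i L i)%:R * (\sum_i D i)%:R / (D i)%:R =
      2 * (\sum_i D i)%:R / ((\sum_i L i)%:R * (D i)%:R) :> R.
    by field; rewrite !lt0r_neq0.
  rewrite ler_pdivrMr ?mulr_gt0 // mulrAC ler_pdivlMr // -!mulrA ler_pM2l //.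
  by rewrite mulrC.
(* the inequalities [cross_le] add up to an equality *)
have cross i : (L i)%:R * (\sum_i D i)%:R = (\sum_i L i)%:R * (D i)%:R :> R.
  apply/eqP; rewrite eq_sym -subr_eq0; apply/eqP.
  apply: (psumr_eq0P (P := predT)
    (F := fun i => (\sum_i L i)%:R * (D i)%:R - (L i)%:R * (\sum_i D i)%:R)) => //.
    by move=> j _; rewrite subr_ge0.
  by rewrite sumrB -mulr_sumr -mulr_suml -!natr_sum subrr.
have ratio i : (D i)%:R / (L i)%:R = (\sum_i D i)%:R / (\sum_i L i)%:R :> R.
  by apply/eqP; rewrite eqr_div ?lt0r_neq0 // mulrC -cross mulrC.
split=> [i|i j]; last by rewrite !ratio.
apply/(sharpP R (hG i) (hD i)) => a b ab; rewrite hL.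
suff -> : 2 / (L i)%:R = 2 / (\sum_i L i)%:R * (\sum_i D i)%:R / (D i)%:R :> R.
  exact: H.
have -> : (\sum_i D i)%:R = (\sum_i L i)%:R * (D i)%:R / (L i)%:R :> R.
  by rewrite -cross mulrAC mulfV ?mul1r ?lt0r_neq0.
by field; rewrite !lt0r_neq0.
Qed.
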